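(* Let $D_1,D_2$ be Prüfer domains. Suppose that there is a homeomorphism $\phi:\mathrm{Spec}(D_1)\to\mathrm{Spec}(D_2)$ (with respect to the Zariski topologies) such that a prime ideal $P$ of $D_1$ is idempotent if and only if $\phi(P)$ is idempotent. If $D_1$ is min-scattered, then there is an isomorphism of ordered sets $\Phi:\mathrm{SStar}_{\mathrm{st}}(D_1)\to\mathrm{SStar}_{\mathrm{st}}(D_2)$.
   Context: Let $D$ be an integral domain with quotient field $K$ and let $\mathbf{F}(D)$ be the set of $D$-submodules of $K$. A semistar operation on $D$ is a map $\star:\mathbf{F}(D)\to\mathbf{F}(D)$, $I\mapsto I^\star$, such that for all $I,J\in\mathbf{F}(D)$ and $x\in K$: $I\subseteq I^\star$; if $I\subseteq J$ then $I^\star\subseteq J^\star$; $(I^\star)^\star=I^\star$; $(xI)^\star=x\cdot I^\star$. Semistar operations are ordered by $\star_1\leq\star_2$ iff $I^{\star_1}\subseteq I^{\star_2}$ for all $I\in\mathbf{F}(D)$. A semistar operation $\star$ is stable if $(I\cap J)^\star=I^\star\cap J^\star$ for all $I,J\in\mathbf{F}(D)$; $\mathrm{SStar}_{\mathrm{st}}(D)$ is the ordered set of stable semistar operations on $D$. A prime $P$ is idempotent if $P=P^2$. For an ideal $I$ of $D$, $\mathrm{Min}(I)$ is the set of minimal primes of $I$, with the subspace topology of the Zariski topology. For a topological space $X$, $\mathcal{D}(X)$ is the set of non-isolated points of $X$; $\mathcal{D}^0(X)=X$, $\mathcal{D}^{\gamma+1}(X)=\mathcal{D}(\mathcal{D}^\gamma(X))$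 and $\mathcal{D}^\alpha(X)=\bigcap_{\beta<\alpha}\mathcal{D}^\beta(X)$ for limit $\alpha$. $X$ is scattered if $\mathcal{D}^\alpha(X)=\emptyset$ for some ordinal $\alpha$. $D$ is min-scattered if $\mathrm{Min}(I)$ is scattered for every ideal $I$ of $D$. *)

(* Defs.v *)
From HB Require Import structures.
From mathcomp Require Import all_boot all_order all_algebra fraction ring_quotient.
From mathcomp Require Import boolp classical_sets functions wochoice.
From mathcomp Require Import topology.

Set Implicit Arguments.
Unset Strict Implicit.
Unset Printing Implicit Defensive.

Import GRing.Theory.
Local Open Scope classical_set_scope.
Local Open Scope ring_scope.

(* The product A B, that is, the set of all finite sums of products a * b. *)
Definition mul_set (R : comNzRingType) (A B : set R) : set R :=
  [set x | exists2 s : seq (R * R),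
     (forall p, p \in s -> A p.1 /\ B p.2) & x = \sum_(p <- s) p.1 * p.2].

Section Ideals.
Variable D : idomainType.

(* Unlike the library's [idealr_closed], this includes the unit ideal. *)
Definition is_ideal (I : set D) : Prop :=
  [/\ I 0, (forall x y, I x -> I y -> I (x + y))
    & forall d x, I x -> I (d * x)].

Definition is_prime_ideal (P : set D) : Prop :=
  idealr_closed (mem P) /\ prime_idealr_closed (mem P).

Definition gen_ideal (s : seq D) : set D :=
  [set x | exists c : 'I_(size s) -> D, x = \sum_(i < size s) c i * s`_i].

Definition is_submodule (I : set {fraction D}) : Prop :=
  [/\ I 0, (forall x y, I x -> I y -> I (x + y))
    & forall (d : D) x, I x -> I (tofrac d * x)].

Definition invertible_ideal (I : set D) : Prop :=
  exists2 J : set {fraction D}, is_submodule J &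
    mul_set (@tofrac D @` I) J = range (@tofrac D).

End Ideals.

Definition prufer (D : idomainType) : Prop :=
  forall s : seq D, gen_ideal s <> [set 0] -> invertible_ideal (gen_ideal s).

Section Spectrum.
Variable D : idomainType.

Record Spec : Type := MkSpec {
  prime_set :> set D;
  prime_setP : is_prime_ideal prime_set
}.

HB.instance Definition _ := gen_eqMixin Spec.
HB.instance Definition _ := gen_choiceMixin Spec.

Definition zariski_closed (S : set D) : set Spec := [set P : Spec | S `<=` P].

Definition zariski_open (U : set Spec) : Prop :=
  exists S : set D, U = ~` zariski_closed S.

Lemma spec0 (P : Spec) : prime_set P 0.
Proof. by have [[+ _ _] _] := prime_setP P => /set_mem. Qed.

Lemma spec1 (P : Spec) : ~ prime_set P 1.
Proof. by have [[_ + _] _] := prime_setP P => /negP P1 /mem_set. Qed.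

Lemma specD (P : Spec) x y : prime_set P x -> prime_set P y -> prime_set P (x + y).
Proof.
have [[_ _ PD] _] := prime_setP P => Px Py.
by have /set_mem := PD 1 x y (mem_set Px) (mem_set Py); rewrite mul1r.
Qed.

Lemma specMl (P : Spec) d x : prime_set P x -> prime_set P (d * x).
Proof.
have [[P0 _ PD] _] := prime_setP P => Px.
by have /set_mem := PD d x 0 (mem_set Px) P0; rewrite addr0.
Qed.

Lemma specM (P : Spec) x y : prime_set P (x * y) -> prime_set P x \/ prime_set P y.
Proof.
have [_ Pp] := prime_setP P => /mem_set/Pp.
by case/orP => /set_mem; [left | right].
Qed.

Lemma zariski_openT : zariski_open setT.
Proof.
exists setT; apply/seteqP; split=> // P _ /(_ 1 I); exact: spec1.
Qed.

Lemma zariski_openI : setI_closed zariski_open.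
Proof.
move=> _ _ [S ->] [S' ->].
exists [set x | exists2 s, S s & exists2 t, S' t & x = s * t].
apply/seteqP; split=> P /=.
  move=> [/existsNP [s /not_implyP [Ss nPs]]].
  move=> /existsNP [t /not_implyP [St nPt]] SP.
  have /SP/specM[] // : exists2 s0, S s0 & exists2 t0, S' t0 & s * t = s0 * t0.
  by exists s => //; exists t.
move=> nP; split=> SP; apply: nP => _ [s Ss [t St ->]].
  by rewrite mulrC; apply/specMl/SP.
by apply/specMl/SP.
Qed.

Lemma zariski_open_bigU (J : Type) (f : J -> set Spec) :
  (forall i, zariski_open (f i)) -> zariski_open (\bigcup_i f i).
Proof.
move=> /choice [S fE]; exists (\bigcup_i S i).
apply/seteqP; split=> P /=.
  move=> [i _]; rewrite fE /= => nP SP; apply: nP => x Sx.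
  by apply: SP; exists i.
move=> /existsNP [x /not_implyP [[i _ Sx] nPx]].
by exists i => //; rewrite fE /= => /(_ x Sx).
Qed.

HB.instance Definition _ := isOpenTopological.Build Spec
  zariski_openT zariski_openI zariski_open_bigU.

Definition idempotent_prime (P : Spec) : Prop :=
  prime_set P = mul_set P P.

Definition minimal_primes (I : set D) : set Spec :=
  [set P : Spec | I `<=` P /\ forall Q : Spec, I `<=` Q -> Q `<=` P -> Q = P].

End Spectrum.

Definition homeomorphism (T U : topologicalType) (f : T -> U) : Prop :=
  exists g : U -> T, [/\ cancel f g, cancel g f, continuous f & continuous g].

Section Scattered.
Variable T : topologicalType.

(* The non-isolated points of A in the subspace topology: [isolated A] is the
   set of the x in A such that V `&` A = [set x] for some neighborhood V. *)
Definition derived (A : set T) : set T := A `\` isolated A.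

(* An element w of a well-ordered type (W, R) stands for the ordinal which is
   the order type of the elements below w; every ordinal arises in this way. *)
Section Ordinals.
Variables (W : eqType) (R : rel W).

Definition below (v w : W) : Prop := R v w /\ v != w.

Definition is_zero (w : W) : Prop := forall v, R w v.

Definition is_succ (v w : W) : Prop :=
  below v w /\ forall u, below v u -> R w u.

Definition is_limit (w : W) : Prop :=
  ~ is_zero w /\ forall v, ~ is_succ v w.

(* When R is a well-order, this characterizes Dr w = D^w(X) by transfinite
   recursion. *)
Definition iterated_derived (X : set T) (Dr : W -> set T) : Prop :=
  [/\ forall w, is_zero w -> Dr w = X,
      forall v w, is_succ v w -> Dr w = derived (Dr v)
    & forall w, is_limit w -> Dr w = \bigcap_(v in [set v | below v w]) Dr v].

End Ordinals.

(* X is scattered for the subspace topology. *)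
Definition scattered (X : set T) : Prop :=
  exists (W : eqType) (R : rel W) (Dr : W -> set T),
    [/\ well_order R, iterated_derived R X Dr & exists w, Dr w = set0].

End Scattered.

Definition min_scattered (D : idomainType) : Prop :=
  forall I : set D, is_ideal I -> scattered (minimal_primes I).

Section Semistar.
Variable D : idomainType.

Record submodule : Type := MkSubmodule {
  submod_set :> set {fraction D};
  submod_setP : is_submodule submod_set
}.

Fact scale_submodP (x : {fraction D}) (I : submodule) :
  is_submodule [set x * y | y in (I : set {fraction D})].
Proof.
have [I0 ID IM] := submod_setP I; split.
- by exists 0; rewrite // mulr0.
- by move=> _ _ [y Iy <-] [z Iz <-]; exists (y + z); rewrite ?mulrDr //; exact: ID.
- by move=> d _ [y Iy <-]; exists (tofrac d * y); [exact: IM | rewrite mulrCA].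
Qed.

Definition scale_submod x I : submodule := MkSubmodule (scale_submodP x I).

Fact cap_submodP (I J : submodule) : is_submodule (I `&` J).
Proof.
have [I0 ID IM] := submod_setP I; have [J0 JD JM] := submod_setP J; split=> //.
- by move=> x y [Ix Jx] [Iy Jy]; split; [exact: ID | exact: JD].
- by move=> d x [Ix Jx]; split; [exact: IM | exact: JM].
Qed.

Definition cap_submod I J : submodule := MkSubmodule (cap_submodP I J).

Definition is_semistar (star : submodule -> submodule) : Prop :=
  [/\ forall I : submodule, I `<=` star I,
      forall I J : submodule, I `<=` J -> star I `<=` star J,
      forall I : submodule, star (star I) = star I
    & forall (x : {fraction D}) (I : submodule),
        star (scale_submod x I) = scale_submod x (star I)].

Definition is_stable (star : submodule -> submodule) : Prop :=
  forall I J : submodule,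
    star (cap_submod I J) = cap_submod (star I) (star J).

Record SStar_st : Type := MkSStar {
  sstar :> submodule -> submodule;
  sstar_semistar : is_semistar sstar;
  sstar_stable : is_stable sstar
}.

Definition sstar_le (s t : SStar_st) : Prop :=
  forall I : submodule, s I `<=` t I.

End Semistar.

Definition order_isomorphism (D1 D2 : idomainType)
    (Phi : SStar_st D1 -> SStar_st D2) : Prop :=
  bijective Phi /\
  forall s t, sstar_le s t <-> sstar_le (Phi s) (Phi t).

(* Main.v *)
(* A stable semistar operation s corresponds to the Gabriel filter F of the ideals
   I of D with 1 in I^s, as x lies in A^s if and only if (A : x) is in F.

   Over a min-scattered Pruefer domain an ideal I is in F as soon as its components
   at its minimal primes are: closing up I, we may assume that (I : x) is in F only
   for x in I; then V(P) is open in V(I) for some minimal prime P of I, and the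
   corresponding splitting of I shows that it cannot miss the component at P.
   For a prime P in F, all P-primary ideals are in F if P is not idempotent, and
   either all of them or P alone if P is idempotent. So F is determined by the set A
   of the primes outside F and the set B of the idempotent primes of F having a primary
   ideal outside F: I is in F if and only if I is contained in no P of A and
   P D_P <= I D_P for all P in B. The pairs (A, B) which arise are described by
   the inclusions between primes and by idempotency, hence can be transported along a
   homeomorphism of spectra. *)
Require Import Defs.
From mathcomp Require Import all_boot all_order all_algebra fraction.
From mathcomp Require Import boolp classical_sets wochoice topology.
From mathcomp Require Import ring.

Set Implicit Arguments.
Unset Strict Implicit.
Unset Printing Implicit Defensive.

Import GRing.Theory.
Local Open Scope classical_set_scope.
Local Open Scope ring_scope.

Local Identity Coercion set_to_pred : set >-> Funclass.

(** * Ideals, primes and contractions of localizations in an integral domain *)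

Section Ideals.
Variable D : idomainType.
Implicit Types (I J : set D) (P Q M : Spec D) (a b s t x y : D).

Lemma idealP0 I : is_ideal I -> I 0. Proof. by case. Qed.

Lemma idealD I x y : is_ideal I -> I x -> I y -> I (x + y).
Proof. by case=> _ + _; apply. Qed.

Lemma idealMl I a x : is_ideal I -> I x -> I (a * x).
Proof. by case=> _ _; apply. Qed.

Lemma idealMr I a x : is_ideal I -> I x -> I (x * a).
Proof. by rewrite mulrC; exact: idealMl. Qed.

Lemma specMr P x y : P x -> P (x * y).
Proof. by rewrite mulrC; exact: specMl. Qed.

Lemma spec_ideal P : is_ideal P.
Proof.
by split; [exact: spec0 | move=> x y; exact: specD | move=> x y; exact: specMl].
Qed.
Hint Resolve spec_ideal : core.

Lemma specNM P x y : ~ P x -> ~ P y -> ~ P (x * y).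
Proof. by move=> nx ny /specM[]. Qed.

Lemma specNX P x n : ~ P x -> ~ P (x ^+ n).
Proof.
move=> nx; elim: n => [|n IHn]; first by rewrite expr0; exact: spec1.
by rewrite exprS; exact: specNM.
Qed.

Lemma spec_eq P Q : P `<=` Q -> Q `<=` P -> P = Q.
Proof.
case: P Q => [P hP] [Q hQ] /= PQ QP.
have {PQ QP} E : P = Q by exact/seteqP.
by move: hP; rewrite E => hP; rewrite (Prop_irrelevance hP hQ).
Qed.

Lemma prime_ideal_of (A : set D) : is_ideal A -> ~ A 1 ->
  (forall x y, A (x * y) -> A x \/ A y) -> is_prime_ideal A.
Proof.
move=> Ai nA1 Ap; split; [split|].
- by apply: mem_set; exact: idealP0.
- by apply/negP => /set_mem.
- move=> a x y /set_mem Ax /set_mem Ay; apply/mem_set.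
  by apply: idealD => //; exact: idealMl.
- by move=> x y /set_mem/Ap[] /mem_set Ax; apply/orP; [left|right].
Qed.

(** Zorn's lemma, with an arbitrary set S: besides multiplicative sets, it will be applied to the
    set of elements comaximal to some minimal prime. *)
Lemma maximal_avoiding (S I : set D) :
  is_ideal I -> (forall x, I x -> ~ S x) ->
  exists A : set D, [/\ is_ideal A, I `<=` A, forall x, A x -> ~ S x &
    forall B : set D, is_ideal B -> A `<=` B -> (forall x, B x -> ~ S x) -> B `<=` A].
Proof.
move=> Ii IS.
pose good (A : set D) := [/\ is_ideal A, I `<=` A & forall x, A x -> ~ S x].
(* [set0] is admitted so that the empty chain has an upper bound. *)
have [F Fgood Ftot|A [Agood Amax]] := @Zorn_bigcup D (fun A => A = set0 \/ good A).
  have [[B [FB [b Bb]]]|noB] := pselect (exists B, F B /\ exists x, B x); last first.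
    left; apply/seteqP; split=> // x [B FB Bx]; apply: noB.
    by exists B; split=> //; exists x.
  right.
  have gd C x : F C -> C x -> good C.
    by move=> FC Cx; case: (Fgood C FC) => // C0; rewrite C0 in Cx.
  have [Bi IB _] := gd _ _ FB Bb.
  split; [split| |].
  - by exists B => //; exact: idealP0.
  - move=> x y [X FX Xx] [Y FY Yy].
    have [[Xi _ _] [Yi _ _]] := (gd _ _ FX Xx, gd _ _ FY Yy).
    have [XY|YX] := Ftot _ _ FX FY.
      by exists Y => //; apply: idealD => //; exact: XY.
    by exists X => //; apply: idealD => //; exact: YX.
  - by move=> d x [X FX Xx]; exists X => //; have [Xi _ _] := gd _ _ FX Xx; exact: idealMl.
  - by move=> x Ix; exists B => //; exact: IB.
  - by move=> x [X FX Xx]; have [_ _] := gd _ _ FX Xx; apply.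
have {}Agood : good A.
  case: Agood => // A0; exfalso; apply: (Amax I); last by right; split.
  by rewrite A0; split=> // /(_ 0 (idealP0 Ii)).
have [Ai IA AS] := Agood; exists A; split=> // B Bi AB BS.
apply: contrapT => nBA; apply: (Amax B); first by split.
by right; split=> //; exact: subset_trans AB.
Qed.

Definition ideal_add I J : set D := [set x | exists y z, [/\ I y, J z & x = y + z]].

Lemma ideal_addP I J : is_ideal I -> is_ideal J -> is_ideal (ideal_add I J).
Proof.
move=> Ii Ji; split.
- by exists 0, 0; rewrite addr0; split=> //; exact: idealP0.
- move=> _ _ [x [y [Ix Jy ->]]] [z [t [Iz Jt ->]]].
  by exists (x + z), (y + t); split; [exact: idealD | exact: idealD | rewrite addrACA].
- move=> d _ [x [y [Ix Jy ->]]].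
  by exists (d * x), (d * y); split; [exact: idealMl | exact: idealMl | rewrite mulrDr].
Qed.

Lemma ideal_addl I J : is_ideal J -> I `<=` ideal_add I J.
Proof. by move=> Ji x Ix; exists x, 0; rewrite addr0; split=> //; exact: idealP0. Qed.

Lemma ideal_addr I J : is_ideal I -> J `<=` ideal_add I J.
Proof. by move=> Ii x Jx; exists 0, x; rewrite add0r; split=> //; exact: idealP0. Qed.

Definition principal a : set D := [set x | exists d, x = d * a].

Lemma principalP a : is_ideal (principal a).
Proof.
split; first by exists 0; rewrite mul0r.
  by move=> _ _ [c ->] [d ->]; exists (c + d); rewrite mulrDl.
by move=> d _ [c ->]; exists (d * c); rewrite mulrA.
Qed.

Lemma principal_id a : principal a a. Proof. by exists 1; rewrite mul1r. Qed.

(** An ideal A maximal among those disjoint from S is prime: for x and y outside A, both A + (x) and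
    A + (y) meet S, and the product of the two elements found lies in S and in A + (xy). *)
Lemma prime_avoiding (S I : set D) :
  is_ideal I -> S 1 -> (forall x y, S x -> S y -> S (x * y)) ->
  (forall x, I x -> ~ S x) -> exists P, I `<=` P /\ forall x, P x -> ~ S x.
Proof.
move=> Ii S1 SM IS.
have [A [Ai IA AS Amax]] := maximal_avoiding Ii IS.
have nA x : ~ A x -> exists y d, [/\ A y & S (y + d * x)].
  move=> nAx; apply: contrapT => no; apply: nAx.
  apply: (Amax (ideal_add A (principal x))).
  - exact/ideal_addP/principalP.
  - exact/ideal_addl/principalP.
  - by move=> _ [y [_ [Ay [d ->] ->]]] Syd; apply: no; exists y, d.
  - exact/ideal_addr/principal_id.
have Ap : is_prime_ideal A.
  apply: prime_ideal_of => // [A1|x y Axy]; first exact: AS A1 S1.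
  apply: contrapT => /not_orP[/nA[u [c [Au Su]]] /nA[v [d [Av Sv]]]].
  apply: AS (SM _ _ Su Sv).
  have -> : (u + c * x) * (v + d * y) = (v + d * y) * u + (c * x * v + c * d * (x * y)).
    by ring.
  by apply: idealD; [|exact: idealMl|apply: idealD; [|exact: idealMl..]].
by exists (MkSpec Ap).
Qed.

Lemma ideal_in_prime I : is_ideal I -> ~ I 1 -> exists P, I `<=` P.
Proof.
move=> Ii nI1; have [||x Ix x1|P [IP _]] := @prime_avoiding [set 1] I Ii => //.
- by move=> _ _ -> ->; rewrite mulr1.
- by apply: nI1; rewrite -x1.
- by exists P.
Qed.

(** Applied to an ideal quotient [colon I x], this proves membership of x in I by checking it at
    each prime. *)
Lemma local_unit I : is_ideal I -> (forall M, exists2 t, ~ M t & I t) -> I 1.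
Proof.
move=> Ii Il; apply: contrapT => nI1.
by have [M IM] := ideal_in_prime Ii nI1; have [t nMt /IM] := Il M.
Qed.

Lemma power_in_ideal I x :
  is_ideal I -> (forall P, I `<=` P -> P x) -> exists n, I (x ^+ n).
Proof.
move=> Ii Px; apply: contrapT => no.
have [|||P [IP PS]] := @prime_avoiding [set y | exists n, y = x ^+ n] I Ii.
- by exists 0%N.
- by move=> _ _ [m ->] [n ->]; exists (m + n)%N; rewrite exprD.
- by move=> x1 Ixn [n xn]; apply: no; exists n; rewrite -xn.
- by apply: (PS x (Px P IP)); exists 1%N.
Qed.

(** The products s x^n with s outside M form a multiplicative set, and a prime disjoint from it lies
    in M and misses x. *)
Lemma local_power_in_ideal I M x :
  is_ideal I -> (forall Q, I `<=` Q -> Q `<=` M -> Q x) ->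
  exists2 s, ~ M s & exists n, I (s * x ^+ n).
Proof.
move=> Ii IMx; apply: contrapT => no.
have [||z Iz|Q [IQ QS]] := @prime_avoiding
    [set y | exists s n, ~ M s /\ y = s * x ^+ n] I Ii.
- by exists 1, 0%N; split; [exact: spec1 | rewrite expr0 mulr1].
- move=> _ _ [s [m [nMs ->]]] [t [n [nMt ->]]].
  by exists (s * t), (m + n)%N; split; [exact: specNM | rewrite exprD; ring].
- by move=> [s [n [nMs E]]]; apply: no; exists s => //; exists n; rewrite -E.
apply: (QS x); last by exists 1, 1%N; split; [exact: spec1 | rewrite mul1r expr1].
apply: IMx => // z Qz; apply: contrapT => nMz.
by apply: (QS z Qz); exists z, 0%N; rewrite expr0 mulr1.
Qed.

Definition colon I x : set D := [set y | I (y * x)].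

Lemma colonP I x : is_ideal I -> is_ideal (colon I x).
Proof.
move=> Ii; split; rewrite /colon /=.
- by rewrite mul0r; exact: idealP0.
- by move=> y z Iy Iz; rewrite mulrDl; exact: idealD.
- by move=> d y Iy; rewrite -mulrA; exact: idealMl.
Qed.

Lemma sub_colon I x : is_ideal I -> I `<=` colon I x.
Proof. by move=> Ii y Iy; exact: idealMr. Qed.

(* The contraction to D of the localization of I at P. *)
Definition sat P I : set D := [set x | exists2 s, ~ P s & I (s * x)].

Lemma satP P I : is_ideal I -> is_ideal (sat P I).
Proof.
move=> Ii; split.
- by exists 1; [exact: spec1 | rewrite mulr0; exact: idealP0].
- move=> x y [s nPs Isx] [t nPt Ity]; exists (s * t); first exact: specNM.
  have -> : s * t * (x + y) = t * (s * x) + s * (t * y) by ring.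
  by apply: idealD => //; exact: idealMl.
- by move=> d x [s nPs Isx]; exists s => //; rewrite mulrCA; exact: idealMl.
Qed.

Lemma sub_sat P I : is_ideal I -> I `<=` sat P I.
Proof. by move=> Ii x Ix; exists 1; [exact: spec1 | exact: idealMl]. Qed.

Lemma sat_sub P I : I `<=` P -> sat P I `<=` P.
Proof. by move=> IP x [s nPs /IP/specM[]]. Qed.

Lemma satS P I J : I `<=` J -> sat P I `<=` sat P J.
Proof. by move=> IJ x [s nPs /IJ]; exists s. Qed.

Definition primary P I : Prop :=
  [/\ is_ideal I, I `<=` P, forall x, P x -> exists n, I (x ^+ n)
    & forall s x, ~ P s -> I (s * x) -> I x].

Lemma sat_primary P I : is_ideal I -> I `<=` P ->
  (forall Q, I `<=` Q -> Q `<=` P -> Q = P) -> primary P (sat P I).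
Proof.
move=> Ii IP Pmin; split; [exact: satP|exact: sat_sub| |]; last first.
  by move=> s x nPs [t nPt Itsx]; exists (t * s); [exact: specNM | rewrite -mulrA].
move=> x Px; have [|s nPs [n Isx]] := @local_power_in_ideal I P x Ii.
  by move=> Q IQ QP; rewrite (Pmin Q).
by exists n; exists s.
Qed.

End Ideals.
#[local] Hint Resolve spec_ideal : core.

Lemma tofrac_inj (D : idomainType) : injective (@tofrac D).
Proof. by move=> x y /eqP; rewrite tofrac_eq => /eqP. Qed.

(** * Prüfer domains: divisibility after localization, the forest of primes, isolated minimal
    primes *)

Section Prufer.
Variables (D : idomainType) (pr : prufer D).
Implicit Types (I J : set D) (P Q M : Spec D) (a b s t x y : D).

(* The localization of D at P is a valuation ring. *)
Lemma prufer_valuation P a b :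
  exists2 s, ~ P s & principal b (s * a) \/ principal a (s * b).
Proof.
have [a0|/eqP a0] := eqVneq a 0.
  by exists 1; [exact: spec1 | left; exists 0; rewrite a0 mulr0 mul0r].
have gen x : gen_ideal [:: a; b] x -> exists c d, x = c * a + d * b.
  by move=> [c ->]; rewrite !big_ord_recl big_ord0 addr0 /=; eexists _, _.
have gena : gen_ideal [:: a; b] a.
  exists (fun i => (i == 0 :> nat)%:R).
  by rewrite !big_ord_recl big_ord0 /= mul1r mul0r !addr0.
have genb : gen_ideal [:: a; b] b.
  exists (fun i => (i == 1 :> nat)%:R).
  by rewrite !big_ord_recl big_ord0 /= mul1r mul0r add0r addr0.
have [E|J [J0 JD JM] JE] := pr (s := [:: a; b]).
  by apply: a0; rewrite E in gena.
have inD x u : gen_ideal [:: a; b] x -> J u -> exists d, tofrac x * u = tofrac d.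
  move=> gx Ju.
  have : range (@tofrac D) (tofrac x * u).
    rewrite -JE; exists [:: (tofrac x, u)]; last by rewrite big_seq1.
    by move=> p; rewrite inE => /eqP -> /=; split=> //; exists x.
  by case=> d _ <-; exists d.
(* As (a, b) J = D, the unit is a combination of a and b with coefficients in J. *)
have [u [v [Ju Jv uv1]]] :
    exists u v, [/\ J u, J v & 1 = tofrac a * u + tofrac b * v].
  have : range (@tofrac D) 1 by exists 1; rewrite // tofrac1.
  rewrite -JE => -[r rP ->]; rewrite big_seq.
  elim/big_ind: _.
  - by exists 0, 0; rewrite !mulr0 addr0.
  - move=> _ _ [u [v [Ju Jv ->]]] [w [z [Jw Jz ->]]].
    exists (u + w), (v + z); split; [exact: JD | exact: JD |].
    by rewrite !mulrDr addrACA.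
  - move=> [x w] /rP /= [[_ /gen[c [d ->]] <-] Jw].
    exists (tofrac c * w), (tofrac d * w); split; [exact: JM | exact: JM |].
    by rewrite tofracD !tofracM; ring.
have [[d1 Ed1] [d2 Ed2]] := (inD _ _ gena Ju, inD _ _ genb Jv).
have [[e Ee] [f Ef]] := (inD _ _ gena Jv, inD _ _ genb Ju).
have d12 : d1 + d2 = 1.
  by apply: (@tofrac_inj D); rewrite tofracD tofrac1 uv1 Ed1 Ed2.
(* As d1 + d2 = 1, one of d1 = au and d2 = bv is outside P and serves as s: d2 a = (av) b and d1 b =
   (bu) a. *)
have [Pd1|nPd1] := pselect (P d1).
  exists d2; first by move=> Pd2; apply: (@spec1 _ P); rewrite -d12; exact: specD.
  left; exists e; apply: (@tofrac_inj D).
  by rewrite !tofracM -Ed2 -Ee; ring.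
exists d1 => //; right; exists f; apply: (@tofrac_inj D).
by rewrite !tofracM -Ed1 -Ef; ring.
Qed.

Lemma prufer_valuation_prime P M x y :
  P `<=` M -> ~ P x -> P y -> exists2 s, ~ M s & principal x (s * y).
Proof.
move=> PM nPx Py; have [s nMs [|[d E]]] := prufer_valuation M y x; first by exists s.
exfalso; have /specM[/PM//|//] : P (s * x) by rewrite E; exact: specMl.
Qed.

(** The primes of the valuation ring D_M form a chain: an element of P outside Q divides every
    element of Q locally at M. *)
Lemma prufer_forest P Q M : P `<=` M -> Q `<=` M -> P `<=` Q \/ Q `<=` P.
Proof.
move=> PM QM; have [|/existsNP[x /not_implyP[Px nQx]]] := pselect (P `<=` Q).
  by left.
right=> y Qy; have [s nMs [d E]] := prufer_valuation_prime QM nQx Qy.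
by have /specM[/PM//|//] : P (s * y) by rewrite E; exact: specMl.
Qed.

(** The primes between I and M form a chain, so their intersection A is prime. *)
Lemma exists_minimal_prime I M : I `<=` M -> exists2 P, minimal_primes I P & P `<=` M.
Proof.
move=> IM; pose A := [set x | forall Q, I `<=` Q -> Q `<=` M -> Q x].
have AM : A `<=` M by move=> x; apply.
have Ap : is_prime_ideal A.
  apply: prime_ideal_of; first split.
  - by move=> Q _ _; exact: spec0.
  - by move=> x y Ax Ay Q IQ QM; apply: specD; [exact: Ax | exact: Ay].
  - by move=> d x Ax Q IQ QM; apply: specMl; exact: Ax.
  - by move=> /AM; exact: spec1.
  - move=> x y Axy; apply: contrapT => /not_orP[].
    move=> /existsNP[Q /not_implyP[IQ /not_implyP[QM nQx]]].
    move=> /existsNP[R /not_implyP[IR /not_implyP[RM nRy]]].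
    have [QR|RQ] := prufer_forest QM RM.
      by have /specM[//|/QR] := Axy Q IQ QM.
    by have /specM[/RQ|//] := Axy R IR RM.
exists (MkSpec Ap) => //; split; first by move=> x Ix Q + _; apply.
by move=> Q IQ QA; apply: spec_eq => //= x; apply=> //; exact: subset_trans AM.
Qed.

Lemma minimal_prime_power I P M x :
  is_ideal I -> minimal_primes I P -> P `<=` M -> P x ->
  exists2 s, ~ M s & exists n, I (s * x ^+ n).
Proof.
move=> Ii [IP Pmin] PM Px; apply: local_power_in_ideal => // Q IQ QM.
have [PQ|QP] := prufer_forest PM QM; first exact: PQ.
by rewrite (Pmin Q IQ QP).
Qed.

Lemma minimal_prime_unique I P Q M :
  minimal_primes I P -> minimal_primes I Q -> P `<=` M -> Q `<=` M -> P = Q.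
Proof.
move=> [IP Pmin] [IQ Qmin] PM QM.
have [PQ|QP] := prufer_forest PM QM; first exact: Qmin.
by rewrite (Pmin Q).
Qed.

(** The basic open set of a meets Min(I) in P alone. This is the form in which min-scatteredness
    enters the proof and passes to the other domain. *)
Definition isolated_minimal_primes : Prop :=
  forall I, is_ideal I -> ~ I 1 -> exists P a, [/\ minimal_primes I P, ~ P a &
    forall Q, minimal_primes I Q -> Q <> P -> Q a].

(* This says that V(P) is open in V(J). An ideal I maximal among those which are
   comaximal to no minimal prime of J has an isolated minimal prime, and this one
   contains P: a minimal prime of J is comaximal to I + (a) only if it is P. *)
Lemma split_minimal_prime J : isolated_minimal_primes -> is_ideal J -> ~ J 1 ->
  exists P e, [/\ minimal_primes J P, P e &
    forall Q, minimal_primes J Q -> Q <> P -> Q (1 - e)].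
Proof.
move=> iso Ji nJ1.
pose S := [set i | exists P p, [/\ minimal_primes J P, P p & i + p = 1]].
have [x Jx [P [p [[JP _] Pp xp]]]|I [Ii JI IS Imax]] := @maximal_avoiding D S J Ji.
  by apply: (@spec1 D P); rewrite -xp; apply: specD => //; exact: JP.
have nI1 : ~ I 1.
  move=> I1; have [M JM] := ideal_in_prime Ji nJ1.
  have [P Pmin _] := exists_minimal_prime JM.
  by apply: (IS _ I1); exists P, 0; split=> //; [exact: spec0 | rewrite addr0].
have [N [a [Nmin nNa Na]]] := iso I Ii nI1.
have IN : I `<=` N by case: Nmin.
pose Ia := ideal_add I (principal a).
have Iai : is_ideal Ia by exact/ideal_addP/principalP.
(* Since a is outside N, I + (a) is strictly larger than I, so by maximality it is comaximal to some
   minimal prime of J. *)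
have [b [Ib [P [p [Pmin Pp bp]]]]] : exists b, Ia b /\ S b.
  apply: contrapT => no; apply: nNa; apply: IN; apply: (Imax Ia) => //.
  - exact/ideal_addl/principalP.
  - by move=> y Iay Sy; apply: no; exists y.
  - exact/ideal_addr/principal_id.
(* I + P' is proper, so some prime M contains it. If the minimal prime of I below M were not N, it
   would contain a, and M would contain I + (a) and P', hence 1. *)
have subN P' b' p' : minimal_primes J P' -> Ia b' -> P' p' -> b' + p' = 1 -> P' `<=` N.
  move=> P'min Iab' P'p' bp'.
  have nIP1 : ~ ideal_add I P' 1.
    by move=> [i [q [Ii' Pq E]]]; apply: (IS _ Ii'); exists P', q.
  have [M IPM] := ideal_in_prime (ideal_addP Ii (spec_ideal P')) nIP1.
  have IM : I `<=` M by apply: subset_trans IPM; exact: ideal_addl.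
  have PM : P' `<=` M by apply: subset_trans IPM; exact: ideal_addr.
  have [N' N'min N'M] := exists_minimal_prime IM.
  have NM : N `<=` M.
    have [<-//|/eqP N'N] := eqVneq N' N.
    exfalso; apply: (@spec1 D M); rewrite -bp'; apply: specD; last exact: PM.
    case: Iab' => i [_ [Ii' [d ->] ->]]; apply: specD; first exact: IM.
    by apply/specMl/N'M/Na.
  have [//|NP'] := prufer_forest PM NM.
  case: P'min => _ P'min; rewrite -(P'min N) //; exact: subset_trans IN.
(* T is the multiplicative set 1 + I + (a), and K below is the contraction of J D_T. It contains
   p. *)
pose T := [set t | Ia (1 - t)].
have T1 : T 1 by rewrite /T /= subrr; exact: idealP0.
have TM s t : T s -> T t -> T (s * t).
  move=> Ts Tt; rewrite /T /=; have -> : 1 - s * t = (1 - s) + s * (1 - t) by ring.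
  by apply: idealD => //; exact: idealMl.
have TX t n : T t -> T (t ^+ n).
  by move=> Tt; elim: n => [|n IHn]; rewrite ?expr0 // exprS; exact: TM.
have Tp : T p by rewrite /T /= -bp addrK.
pose K := [set x | exists2 t, T t & J (t * x)].
have Ki : is_ideal K.
  split; first by exists 1 => //; rewrite mulr0; exact: idealP0.
    move=> x y [s Ts Jsx] [t Tt Jty]; exists (s * t); first exact: TM.
    have -> : s * t * (x + y) = t * (s * x) + s * (t * y) by ring.
    by apply: idealD => //; exact: idealMl.
  by move=> d x [s Ts Jsx]; exists s => //; rewrite mulrCA; exact: idealMl.
(* At a prime M above K and P, some s p^n with s outside M lies in J; as p^n is in T, this puts s
   into K, hence into M. *)
have [k [e [Kk Pe E]]] : ideal_add K P 1.
  apply: contrapT => no.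
  have [M KPM] := ideal_in_prime (ideal_addP Ki (spec_ideal P)) no.
  have PM : P `<=` M by apply: subset_trans KPM; exact: ideal_addr.
  have [s nMs [n Jsp]] := minimal_prime_power Ji Pmin PM Pp.
  apply: nMs; apply: KPM; apply: ideal_addl => //.
  by exists (p ^+ n); [exact: TX | rewrite mulrC].
exists P, e; split=> // Q Qmin QP.
have -> : 1 - e = k by rewrite E addrK.
have [JQ _] := Qmin.
(* A minimal prime Q meeting T is comaximal to I + (a), so it lies in N, as P does; hence Q = P. *)
case: Kk => t Tt /JQ/specM[Qt|//]; exfalso; apply: QP.
have QN : Q `<=` N by apply: (subN Q (1 - t) t) => //; rewrite subrK.
by apply: (minimal_prime_unique Qmin Pmin QN); exact: (subN P b p).
Qed.

End Prufer.

(** * Gabriel filters and the local-global principle over Prüfer domains *)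

Section Gabriel.
Variable D : idomainType.
Implicit Types (I J L : set D) (P Q M : Spec D) (a b s t x y : D).

Definition gabriel (F : set (set D)) : Prop :=
  [/\ forall I, F I -> is_ideal I, F setT,
      forall I J, is_ideal J -> I `<=` J -> F I -> F J,
      forall I x, F I -> F (colon I x)
    & forall I J, is_ideal J -> F I -> (forall x, I x -> F (colon J x)) -> F J].

Lemma gabrielI F I J : gabriel F -> F I -> F J -> F (I `&` J).
Proof.
move=> [Fi FT Fup Fcol Fext] FI FJ.
have [Ii Ji] := (Fi _ FI, Fi _ FJ).
have IJi : is_ideal (I `&` J).
  split; first by split; exact: idealP0.
    by move=> x y [Ix Jx] [Iy Jy]; split; exact: idealD.
  by move=> d x [Ix Jx]; split; exact: idealMl.
apply: (Fext I) => // x Ix; apply: (Fup (colon J x)); [exact: colonP | | exact: Fcol].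
by move=> y Jyx; split=> //; exact: idealMl.
Qed.

Lemma gabriel_closure_ideal F I :
  gabriel F -> is_ideal I -> is_ideal [set x | F (colon I x)].
Proof.
move=> Fg Ii; have [Fi FT Fup Fcol Fext] := Fg; split=> /=.
- apply: (Fup setT) => //; first exact: colonP.
  by move=> y _; rewrite /colon /= mulr0; exact: idealP0.
- move=> x y Fx Fy; apply: (Fup _ _ _ _ (gabrielI Fg Fx Fy)); first exact: colonP.
  by move=> z [Ixz Iyz]; rewrite /colon /= mulrDr; exact: idealD.
- move=> d x Fx; apply: (Fup _ _ _ _ Fx); first exact: colonP.
  by move=> z Izx; rewrite /colon /= mulrCA; exact: idealMl.
Qed.

(** As I is contained in p D_P, each x in I satisfies (L : p^(k+1)) <= ((L : p^k) : x). So
    membership in F descends from (L : p^n) = D to (L : p^0) = L. *)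
Lemma gabriel_primary F P I L p n :
  gabriel F -> F I -> primary P L -> L (p ^+ n) ->
  (forall x, I x -> exists2 s, ~ P s & principal p (s * x)) -> F L.
Proof.
move=> [Fi FT Fup Fcol Fext] FI [Li LP Lrad Lprim] Lpn Idiv.
suff H m : (m <= n)%N -> F (colon L (p ^+ (n - m))).
  have := H n (leqnn n); rewrite subnn expr0 => FL.
  by apply: (Fup _ _ _ _ FL) => // x; rewrite /colon /= mulr1.
elim: m => [_|m IHm mn].
  apply: (Fup setT) => //; first exact: colonP.
  by move=> y _; rewrite subn0; exact: idealMl.
apply: (Fext I) => //; first exact: colonP.
move=> x Ix; have [s nPs [d E]] := Idiv x Ix.
apply: Fup (IHm (ltnW mn)); first by do 2!apply: colonP.
move=> y; rewrite /colon /= -(subnSK mn) exprS => Ly.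
apply: (Lprim s) => //.
have -> : s * (y * x * p ^+ (n - m.+1)) = y * (s * x) * p ^+ (n - m.+1) by ring.
rewrite E.
have -> : y * (d * p) * p ^+ (n - m.+1) = d * (y * (p * p ^+ (n - m.+1))) by ring.
exact: idealMl.
Qed.

Hypothesis pr : prufer D.

(** Suppose that the closure J of I is proper and split off a minimal prime P of J. A power u of 1 -
    e multiplies [sat P J] into J; as [sat P J] is in F, this gives u in J, although u is outside
    P. *)
Lemma prufer_local_global F I : isolated_minimal_primes D -> gabriel F -> is_ideal I ->
  (forall P, minimal_primes I P -> F (sat P I)) -> F I.
Proof.
move=> iso Fg Ii Floc; have [Fi FT Fup Fcol Fext] := Fg.
pose J := [set x | F (colon I x)].
have Ji : is_ideal J by exact: gabriel_closure_ideal.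
have IJ : I `<=` J.
  move=> x Ix; apply: (Fup setT) => //; first exact: colonP.
  by move=> y _; exact: idealMl.
have Jcl x : F (colon J x) -> J x.
  move=> FJx; apply: (Fext _ _ _ FJx); first exact: colonP.
  move=> y FIyx; apply: (Fup _ _ _ _ FIyx); first by do 2!apply: colonP.
  by move=> z; rewrite /colon /= mulrA.
have [J1|nJ1] := pselect (J 1).
  by apply: (Fup _ _ _ _ J1) => // x; rewrite /colon /= mulr1.
exfalso.
have [P [e [Pmin Pe Qe]]] := split_minimal_prime pr iso Ji nJ1.
have JP : J `<=` P by case: Pmin.
(* A minimal prime Q of I below P is either P itself or does not contain J; in the second case Q D_P
   is contained in J D_P. *)
have FL : F (sat P J).
  have [Q Qmin QP] := exists_minimal_prime pr (subset_trans IJ JP).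
  have [QE|/eqP nQP] := eqVneq Q P.
    by rewrite -QE; apply: Fup (Floc Q Qmin); [exact: satP | exact: satS].
  have IQ : I `<=` Q by case: Qmin.
  apply: Fup (Floc Q Qmin); first exact: satP.
  apply: (subset_trans (sat_sub IQ)) => z Qz.
  have /existsNP[y /not_implyP[Jy nQy]] : ~ (J `<=` Q).
    by move=> JQ; apply: nQP; case: Pmin => _; apply.
  have [s nPs [d E]] := prufer_valuation_prime pr QP nQy Qz.
  by exists s => //; rewrite E; exact: idealMl.
have FP : F P by apply: Fup FL; [exact: spec_ideal | exact: sat_sub].
have [n Jn] : exists n, J ((e * (1 - e)) ^+ n).
  apply: power_in_ideal => // R JR; have [Q Qmin QR] := exists_minimal_prime pr JR.
  apply: QR; have [->|/eqP QP] := eqVneq Q P; first exact: specMr.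
  exact/specMl/Qe.
pose u := (1 - e) ^+ n.
(* As P is in F and J is closed, it suffices that y u x is in J for y in P. Locally at M above P, s
   divides y; at the other primes M above J, e is a unit and (e (1 - e))^n is in J. *)
have Jux x : sat P J x -> J (u * x).
  move=> [s nPs Jsx]; apply: Jcl; apply: Fup FP; first exact: colonP.
  move=> y Py; have colJ : is_ideal (colon J (y * (u * x))) by exact: colonP.
  suff : colon J (y * (u * x)) 1 by rewrite /colon /= mul1r.
  apply: local_unit => // M.
  have [JM|/existsNP[t /not_implyP[Jt nMt]]] := pselect (J `<=` M); last first.
    by exists t => //; exact: idealMr.
  have [Q Qmin QM] := exists_minimal_prime pr JM.
  have [QE|/eqP QP] := eqVneq Q P.
    rewrite QE in QM; have [t nMt [d E]] := prufer_valuation_prime pr QM nPs Py.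
    exists t => //; rewrite /colon /=.
    have -> : t * (y * (u * x)) = t * y * (u * x) by ring.
    rewrite E; have -> : d * s * (u * x) = d * u * (s * x) by ring.
    exact: idealMl.
  have Me : M (1 - e) by exact/QM/Qe.
  have nMe : ~ M e.
    by move=> /specD/(_ Me); rewrite addrC subrK; exact: spec1.
  exists (e ^+ n); first exact: specNX.
  rewrite /colon /=; have -> : e ^+ n * (y * (u * x)) = y * x * (e ^+ n * u) by ring.
  by rewrite -exprMn; exact: idealMl.
have Ju : J u.
  apply: Jcl; apply: Fup FL; first exact: colonP.
  by move=> x /Jux; rewrite /colon /= mulrC.
move: (JP _ Ju); apply: specNX => /specD/(_ Pe).
by rewrite subrK; exact: spec1.
Qed.

(** * Squares of primes and nonidempotent primes *)

Lemma mul_setM (P : set D) x y : P x -> P y -> mul_set P P (x * y).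
Proof.
move=> Px Py; exists [:: (x, y)]; last by rewrite big_seq1.
by move=> p; rewrite inE => /eqP ->.
Qed.

Lemma mul_set_ideal P : is_ideal (mul_set P P).
Proof.
split; first by exists [::]; rewrite ?big_nil.
  move=> _ _ [r rP ->] [r' r'P ->]; exists (r ++ r'); last by rewrite big_cat.
  by move=> p; rewrite mem_cat => /orP[/rP|/r'P].
move=> d _ [r rP ->]; exists [seq (d * p.1, p.2) | p <- r].
  by move=> _ /mapP[p /rP[Pp1 Pp2] ->]; split=> //; exact: specMl.
by rewrite big_map mulr_sumr; apply: eq_bigr => p _; rewrite mulrA.
Qed.

Lemma sum_closed_mul_set (A B : set D) (Z : set D) :
  Z 0 -> (forall x y, Z x -> Z y -> Z (x + y)) ->
  (forall u v, A u -> B v -> Z (u * v)) -> mul_set A B `<=` Z.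
Proof.
move=> Z0 ZD ZM _ [r rP ->]; rewrite big_seq; elim/big_ind: _ => // p /rP[].
exact: ZM.
Qed.

(** Thus an element of P outside P^2 remains outside P^2 D_P. *)
Lemma prufer_sat_square P : sat P (mul_set P P) `&` P `<=` mul_set P P.
Proof.
move=> x [[s nPs Psx] Px]; have P2i := mul_set_ideal P.
suff : colon (mul_set P P) x 1 by rewrite /colon /= mul1r.
apply: local_unit; first exact: colonP.
move=> M; have [PM|/existsNP[t /not_implyP[Pt nMt]]] := pselect (P `<=` M); last first.
  by exists t => //; rewrite /colon /=; exact: mul_setM.
(* Locally at M every element of P is divisible by s, hence P^2 = s P^2. *)
have [t nMt [d [P2d E]]] :
    exists2 t, ~ M t & exists d, mul_set P P d /\ t * (s * x) = s * d; last first.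
  exists t => //; rewrite /colon /=.
  have s0 : s != 0 by apply: contra_notN nPs => /eqP ->; exact: spec0.
  by have -> : t * x = d by apply: (mulfI s0); rewrite -E; ring.
apply: (sum_closed_mul_set (Z := [set z |
    exists2 t, ~ M t & exists d, mul_set P P d /\ t * z = s * d])) Psx.
- by exists 1; [exact: spec1 | exists 0; split; [exact: idealP0 | rewrite !mulr0]].
- move=> y z [t nMt [d [P2d Ed]]] [t' nMt' [d' [P2d' Ed']]].
  exists (t * t'); first exact: specNM.
  exists (t' * d + t * d'); split; first by apply: idealD => //; exact: idealMl.
  have -> : t * t' * (y + z) = t' * (t * y) + t * (t' * z) by ring.
  by rewrite Ed Ed'; ring.
- move=> u v Pu Pv; have [t nMt [w E]] := prufer_valuation_prime pr PM nPs Pu.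
  exists t => //; exists (w * v); split; last by rewrite mulrA E; ring.
  have /specM[Pw|//] : P (w * s) by rewrite -E; exact: specMl.
  exact: mul_setM.
Qed.

(** An element p of P outside P^2 generates P D_P: if s p = d x with x in P and s outside P, then d
    is outside P. So [gabriel_primary] applies with I = P. *)
Lemma gabriel_nonidempotent F P L :
  gabriel F -> F P -> ~ idempotent_prime P -> primary P L -> F L.
Proof.
move=> Fg FP nidem Lprim; have [Li LP Lrad Lsat] := Lprim.
have sqP : mul_set P P `<=` P.
  apply: sum_closed_mul_set; [exact: spec0 | by move=> x y; exact: specD |].
  by move=> u v Pu Pv; exact: specMl.
have /existsNP[p /not_implyP[Pp nsq]] : ~ (P `<=` mul_set P P).
  by move=> Psq; apply: nidem; exact/seteqP.
have [n Lpn] := Lrad p Pp.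
apply: (gabriel_primary Fg FP Lprim Lpn) => x Px.
have [s nPs [|[d E]]] := prufer_valuation pr P x p; first by exists s.
have [Pd|nPd] := pselect (P d); last by exists d => //; exists s.
exfalso; apply: nsq; apply: prufer_sat_square; split=> //.
by exists s => //; rewrite E; exact: mul_setM.
Qed.

End Gabriel.

(** * Stable semistar operations correspond to Gabriel filters omitting the zero ideal *)

Section StableStars.
Variable D : idomainType.
Implicit Types (I J : set D) (A B : submodule D) (x : {fraction D}).

Lemma submod_ext A B : A `<=` B -> B `<=` A -> A = B.
Proof.
case: A B => [A hA] [B hB] /= AB BA.
have {AB BA} E : A = B by exact/seteqP.
by move: hA; rewrite E => hA; rewrite (Prop_irrelevance hA hB).
Qed.

Fact frac_submodP I : is_ideal I -> is_submodule (@tofrac D @` I).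
Proof.
move=> Ii; split.
- by exists 0; [exact: idealP0 | rewrite tofrac0].
- by move=> _ _ [a Ia <-] [b Ib <-]; exists (a + b); [exact: idealD | rewrite tofracD].
- by move=> d _ [a Ia <-]; exists (d * a); [exact: idealMl | rewrite tofracM].
Qed.

Definition frac_submod I (Ii : is_ideal I) : submodule D := MkSubmodule (frac_submodP Ii).

Lemma frac_submodE I (Ii : is_ideal I) a : frac_submod Ii (tofrac a) = I a.
Proof. by apply/propext; split=> [[b Ib /tofrac_inj <-]|Ia] //; exists a. Qed.

Definition frac_colon A x : set D := [set d | A (tofrac d * x)].

Lemma frac_colonP A x : is_ideal (frac_colon A x).
Proof.
have [A0 AD AM] := submod_setP A; split; rewrite /frac_colon /=.
- by rewrite tofrac0 mul0r.
- by move=> a b Aa Ab; rewrite tofracD mulrDl; exact: AD.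
- by move=> d a Aa; rewrite tofracM -mulrA; exact: AM.
Qed.

Lemma ideal_setT : is_ideal [set: D]. Proof. by []. Qed.

Definition star_filter (s : submodule D -> submodule D) : set (set D) :=
  [set I | exists Ii : is_ideal I, s (frac_submod Ii) 1].

Section Filter.
Variable s : SStar_st D.

Let s_ext A : A `<=` s A. Proof. by have [+ _ _ _] := sstar_semistar s; apply. Qed.
Let s_mono A B : A `<=` B -> s A `<=` s B.
Proof. by have [_ + _ _] := sstar_semistar s; apply. Qed.

(** For nonzero x, (A : x) is the intersection of x^-1 A and D; stability and the scaling axiom
    compute its image under s. *)
Lemma sstar_filter_colon A x : s A x <-> star_filter s (frac_colon A x).
Proof.
have s1 : s (frac_submod ideal_setT) 1 by apply: s_ext; exists 1; rewrite ?tofrac1.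
have [->|x0] := eqVneq x 0.
  split=> _; last by case: (submod_setP (s A)).
  exists (frac_colonP A 0); apply: s_mono s1 => _ [d _ <-].
  exists d => //; rewrite /frac_colon /= mulr0; by case: (submod_setP A).
have E : frac_submod (frac_colonP A x) =
    cap_submod (scale_submod x^-1 A) (frac_submod ideal_setT).
  apply: submod_ext => [_ [d Ad <-]|_ [[y Ay <-] [d _ E]]].
    by split; [exists (tofrac d * x); rewrite // mulrCA mulVf // mulr1 | exists d].
  by exists d => //; rewrite /frac_colon /= E mulrAC mulVf // mul1r.
have [_ _ _ sM] := sstar_semistar s.
have sE : s (frac_submod (frac_colonP A x)) =
    cap_submod (scale_submod x^-1 (s A)) (s (frac_submod ideal_setT)).
  by rewrite E (sstar_stable s) sM.
split=> [sx|[Ii]].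
  by exists (frac_colonP A x); rewrite sE; split=> //; exists x; rewrite // mulVf.
rewrite (Prop_irrelevance Ii (frac_colonP A x)) sE => -[[y sy yx] _].
by have -> : x = y by rewrite -[LHS]mulr1 -yx mulrA mulfV // mul1r.
Qed.

Lemma frac_submod_colon I (Ii : is_ideal I) a :
  frac_colon (frac_submod Ii) (tofrac a) = colon I a.
Proof. by apply/funext => d; rewrite /frac_colon /colon /mkset -tofracM frac_submodE. Qed.

Lemma star_filter_gabriel : gabriel (star_filter s).
Proof.
split.
- by move=> I [].
- by exists ideal_setT; apply: s_ext; exists 1; rewrite ?tofrac1.
- move=> I J Ji IJ [Ii s1]; exists Ji; apply: s_mono s1 => _ [a Ia <-].
  by exists a => //; exact: IJ.
- move=> I a [Ii s1]; rewrite -(frac_submod_colon Ii); apply/sstar_filter_colon.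
  have [_ _ sM] := submod_setP (s (frac_submod Ii)).
  by rewrite -[tofrac a]mulr1; exact: sM.
- move=> I J Ji [Ii s1] FJ; exists Ji.
  (* The assumption on J says that I is contained in J^s, so 1 lies in I^s <= (J^s)^s = J^s. *)
  have [_ _ ss _] := sstar_semistar s; rewrite -ss.
  apply: s_mono s1 => _ [a Ia <-]; apply/sstar_filter_colon.
  by rewrite frac_submod_colon; exact: FJ.
Qed.

(** Scaling by 0 is allowed and forces the image of the zero module to be zero. *)
Lemma star_filter_proper : ~ star_filter s [set 0].
Proof.
move=> [Ii s1]; have [_ _ _ sM] := sstar_semistar s.
have E : frac_submod Ii = scale_submod 0 (frac_submod Ii).
  apply: submod_ext => [_ [_ -> <-]|_ [y _ <-]].
    by exists 0; rewrite ?mulr0 ?tofrac0 //; exists 0; rewrite ?tofrac0.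
  by exists 0; rewrite // tofrac0 mul0r.
by move: s1; rewrite E sM => -[y _ /eqP]; rewrite mul0r eq_sym oner_eq0.
Qed.

End Filter.

Lemma sstar_le_filter (s t : SStar_st D) :
  sstar_le s t <-> star_filter s `<=` star_filter t.
Proof.
split=> [st I [Ii s1]|st A x]; first by exists Ii; exact: st.
by move=> /sstar_filter_colon/st/sstar_filter_colon.
Qed.

Lemma star_filter_inj (s t : SStar_st D) : star_filter s = star_filter t -> s = t.
Proof.
move=> E; have : sstar_le s t /\ sstar_le t s by split; apply/sstar_le_filter; rewrite E.
case: s t {E} => [s s1 s2] [t t1 t2] [/= st ts].
have E : s = t by apply/funext => A; apply: submod_ext; [exact: st | exact: ts].
by move: s1 s2 {st ts}; rewrite E => s1 s2; congr MkSStar; exact: Prop_irrelevance.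
Qed.

(* The converse of [sstar_filter_colon]: x is in A^* when (A : x) is in F. *)
Lemma gabriel_star_filter (F : set (set D)) :
  gabriel F -> ~ F [set 0] -> exists s : SStar_st D, star_filter s = F.
Proof.
move=> Fg nF0; have [Fi FT Fup Fcol Fext] := Fg.
pose fstar (A : submodule D) := [set x | F (frac_colon A x)].
have fstarP A : is_submodule (fstar A).
  have [A0 AD AM] := submod_setP A; split; rewrite /fstar /=.
  - apply: Fup FT; [exact: frac_colonP | move=> d _].
    by rewrite /frac_colon /= mulr0.
  - move=> x y Fx Fy; apply: Fup (gabrielI Fg Fx Fy); first exact: frac_colonP.
    by move=> d [Ax Ay]; rewrite /frac_colon /= mulrDr; exact: AD.
  - move=> d x Fx; apply: Fup Fx; first exact: frac_colonP.
    by move=> a Ax; rewrite /frac_colon /= mulrCA; exact: AM.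
pose star A := MkSubmodule (fstarP A).
have star_semi : is_semistar star.
  have ext A : A `<=` star A.
    move=> x Ax; apply: Fup FT; first exact: frac_colonP.
    by move=> d _; have [_ _ AM] := submod_setP A; exact: AM.
  have mono A B : A `<=` B -> star A `<=` star B.
    by move=> AB x; apply: Fup; [exact: frac_colonP | move=> d; exact: AB].
  split=> //.
  - move=> A; apply: submod_ext; last exact: ext.
    move=> x Fx; apply: (Fext _ _ _ Fx); first exact: frac_colonP.
    move=> d FAdx; apply: Fup FAdx; first exact/colonP/frac_colonP.
    by move=> a; rewrite /colon /frac_colon /= tofracM -mulrA.
  - move=> x A; have [->|x0] := eqVneq x 0.
      apply: submod_ext => [y Fy|_ [y _ <-]]; last first.
        by rewrite mul0r; case: (submod_setP (star (scale_submod 0 A))).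
      exists 0; first by case: (submod_setP (star A)).
      (* For nonzero y the ideal (0 : y) is zero, hence not in F. *)
      rewrite mul0r; apply/esym/eqP; apply: contra_notT nF0 => y0.
      apply: Fup Fy.
        split=> // [_ _ -> ->|d _ ->]; [exact: addr0 | exact: mulr0].
      move=> d [z _]; rewrite mul0r => /esym/eqP; rewrite mulf_eq0 (negPf y0) orbF.
      by rewrite -tofrac0 tofrac_eq => /eqP.
    have E y : frac_colon (scale_submod x A) y = frac_colon A (x^-1 * y).
      apply/seteqP; split=> d; rewrite /frac_colon /=.
        by move=> [z Az E]; rewrite mulrCA -E mulKf.
      by move=> Ady; exists (tofrac d * (x^-1 * y)) => //; rewrite mulrCA mulVKf.
    apply: submod_ext => y /=.
      by rewrite /fstar /= E => Fy; exists (x^-1 * y); rewrite // mulVKf.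
    by move=> [z Fz <-]; rewrite /fstar /= E mulKf.
have star_st : is_stable star.
  move=> A B; apply: submod_ext => x /=.
    by move=> Fx; split; apply: Fup Fx; try exact: frac_colonP; move=> d [].
  move=> [Fx Fy]; apply: Fup (gabrielI Fg Fx Fy); first exact: frac_colonP.
  by move=> d [].
exists (MkSStar star_semi star_st); apply/seteqP.
have E I (Ii : is_ideal I) : frac_colon (frac_submod Ii) 1 = I.
  by apply/funext => d; rewrite /frac_colon /mkset mulr1 frac_submodE.
split=> I; first by move=> [Ii]; rewrite /= /fstar /= E.
by move=> FI; exists (Fi _ FI); rewrite /= /fstar /= E.
Qed.

End StableStars.

(** * Gabriel filters described by pairs of sets of primes *)

Section SpectralPairs.
Variable D : idomainType.
Implicit Types (I J L : set D) (P Q M : Spec D) (A B : set (Spec D)).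

Definition pair_filter A B : set (set D) :=
  [set I | [/\ is_ideal I, forall P, A P -> ~ (I `<=` P) & forall P, B P -> P `<=` sat P I]].

(** Idempotency gives the last axiom at P in B: for u, v in P, first su is in I, then tv su is in J,
    and the products uv generate P^2 = P. *)
Lemma pair_filter_gabriel A B :
  (forall P, B P -> idempotent_prime P) -> gabriel (pair_filter A B).
Proof.
move=> Bid.
have up I J : is_ideal J -> I `<=` J -> pair_filter A B I -> pair_filter A B J.
  move=> Ji IJ [Ii IA IB]; split=> // P.
    by move=> AP JP; apply: (IA P AP); exact: subset_trans JP.
  by move=> BP; apply: (subset_trans (IB P BP)); exact: satS.
split=> //.
- by move=> I [].
- split=> //; first by move=> P AP /(_ 1 Logic.I); exact: spec1.
  by move=> P BP x _; exists 1 => //; exact: spec1.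
- by move=> I x FI; have [Ii _ _] := FI; apply: up FI; [exact: colonP | exact: sub_colon].
- move=> I J Ji [Ii IA IB] IJ; split=> // P.
    move=> AP JP; apply: (IA P AP) => x Ix; apply: contrapT => nPx.
    have [_ /(_ P AP) + _] := IJ x Ix; apply => y /JP/specM[//|Px].
    by exfalso.
  move=> BP; rewrite {1}(Bid P BP); have satJ := satP P Ji.
  apply: (sum_closed_mul_set (Z := sat P J)).
  + exact: idealP0.
  + by move=> x y; exact: idealD.
  + move=> u v Pu Pv; have [s nPs Isu] := IB P BP u Pu.
    have [_ _ /(_ P BP v Pv)[t nPt]] := IJ _ Isu.
    rewrite /colon /= => Jtvsu; exists (t * s); first exact: specNM.
    by have -> : t * s * (u * v) = t * v * (s * u) by ring.
Qed.

Lemma pair_filter_proper A B : A !=set0 -> ~ pair_filter A B [set 0].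
Proof. by move=> [P AP] [_ /(_ P AP) + _]; apply=> _ ->; exact: spec0. Qed.

(** At a prime P in A, I is not contained in P, so I D_P = D_P and the condition for B' holds. *)
Lemma pair_filterS A B A' B' : A' `<=` A -> B' `<=` A `|` B ->
  pair_filter A B `<=` pair_filter A' B'.
Proof.
move=> AA BB I [Ii IA IB]; split=> // P; first by move=> /AA; exact: IA.
move=> /BB[AP|]; last exact: IB.
have /existsNP[s /not_implyP[Is nPs]] := IA P AP.
by move=> p _; exists s => //; exact: idealMr.
Qed.

(* P is the union of the primes strictly below it if and only if no prime
   strictly below P contains all the others. *)
Definition branched P : Prop := exists R : Spec D,
  [/\ R `<=` P, R <> P & forall Q, Q `<=` P -> Q <> P -> Q `<=` R].

(** For P in B, branchedness provides a proper P-primary ideal; the primes strictly below P are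
    contained in every P-primary ideal, so they must be in A. A nonempty A excludes the zero ideal
    from the filter. *)
Definition standard_pair A B : Prop :=
  [/\ A !=set0, forall P Q, A Q -> P `<=` Q -> A P
    & forall P, B P -> [/\ idempotent_prime P, ~ A P, branched P
        & forall Q, Q `<=` P -> Q <> P -> A Q]].

Definition prime_support (F : set (set D)) : set (Spec D) := [set P : Spec D | ~ F P].

Definition primary_support (F : set (set D)) : set (Spec D) :=
  [set P : Spec D | [/\ idempotent_prime P, F P & exists2 L, primary P L & ~ F L]].

Hypothesis pr : prufer D.

Lemma zero_prime : is_prime_ideal [set (0 : D)].
Proof.
apply: prime_ideal_of; first split=> //.
- by move=> _ _ -> ->; exact: addr0.
- by move=> d _ ->; exact: mulr0.
- by move=> /eqP; rewrite oner_eq0.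
- by move=> x y /eqP; rewrite mulf_eq0 => /orP[]/eqP; [left|right].
Qed.

(** L has radical P, so it has an element outside Q, and this element divides all of Q locally at
    P. *)
Lemma strict_prime_sub_primary P Q L :
  primary P L -> Q `<=` P -> Q <> P -> Q `<=` L.
Proof.
move=> [Li LP Lrad Lsat] QP nQP x Qx.
have /existsNP[y /not_implyP[Ly nQy]] : ~ (L `<=` Q).
  move=> LQ; apply: nQP; apply: spec_eq => // z Pz.
  have [n /LQ Qzn] := Lrad z Pz; apply: contrapT => nQz; exact: (specNX nQz) Qzn.
have [s nPs [d E]] := prufer_valuation_prime pr QP nQy Qx.
by apply: (Lsat s) => //; rewrite E; exact: idealMl.
Qed.

(** The union R of the primes strictly below P is prime, as they form a chain, and lies in L, so it
    is not P. *)
Lemma proper_primary_branched P L :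
  prime_set P <> [set 0] -> primary P L -> ~ (P `<=` L) -> branched P.
Proof.
move=> P0 Lprim nPL.
pose R := [set x | exists Q : Spec D, [/\ Q `<=` P, Q <> P & Q x]].
have Rp : is_prime_ideal R.
  apply: prime_ideal_of; first split.
  - exists (MkSpec zero_prime); split=> //.
      by move=> _ ->; exact: spec0.
    by move=> E; apply: P0; rewrite -E.
  - move=> x y [Q [QP nQP Qx]] [Q' [QP' nQP' Qy]].
    have [QQ|QQ] := prufer_forest pr QP QP'.
      by exists Q'; split=> //; apply: specD => //; exact: QQ.
    by exists Q; split=> //; apply: specD => //; exact: QQ.
  - by move=> d x [Q [QP nQP Qx]]; exists Q; split=> //; exact: specMl.
  - by move=> [Q [_ _]]; exact: spec1.
  - by move=> x y [Q [QP nQP /specM[Qx|Qy]]]; [left | right]; exists Q.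
exists (MkSpec Rp); split=> /=.
- by move=> x [Q [QP _ /QP]].
- move=> RP; apply: nPL; rewrite -RP => x [Q [QP nQP Qx]].
  exact: (strict_prime_sub_primary Lprim QP nQP).
- by move=> Q QP nQP x Qx; exists Q.
Qed.

Lemma support_standard F : gabriel F -> ~ F [set 0] ->
  standard_pair (prime_support F) (primary_support F).
Proof.
move=> [Fi FT Fup Fcol Fext] nF0; split.
- by exists (MkSpec zero_prime).
- by move=> P Q nFQ PQ FP; apply: nFQ; apply: Fup FP.
- move=> P [Pid FP [L Lprim nFL]]; have [Li _ _ _] := Lprim; split=> //.
  + apply: (proper_primary_branched _ Lprim) => [P0|PL]; first by rewrite P0 in FP.
    by apply: nFL; apply: Fup FP.
  + move=> Q QP nQP FQ; apply: nFL; apply: Fup FQ => //.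
    exact: strict_prime_sub_primary QP nQP.
Qed.

Lemma gabriel_pair_filter F : isolated_minimal_primes D -> gabriel F ->
  pair_filter (prime_support F) (primary_support F) = F.
Proof.
move=> iso Fg; have [Fi FT Fup Fcol Fext] := Fg; apply/seteqP; split=> I.
  move=> [Ii IA IB]; apply: (prufer_local_global pr iso) => // P [IP Pmin].
  have FP : F P by apply: contrapT => nFP; exact: (IA P nFP IP).
  have satprim : primary P (sat P I) by exact: sat_primary.
  apply: contrapT => nFL; have [Pid|nid] := pselect (idempotent_prime P).
    have BP : primary_support F P by split=> //; exists (sat P I).
    by apply: nFL; apply: Fup FP; [exact: satP | exact: IB].
  exact/nFL/(gabriel_nonidempotent pr Fg FP nid satprim).
move=> FI; split=> [|P nFP IP|P [Pid FP [L Lprim nFL]] p Pp]; first exact: Fi.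
  by apply: nFP; apply: Fup FI.
(* If p is not in I D_P, then I D_P is contained in p D_P, and [gabriel_primary] puts L into F. *)
apply: contrapT => nsat; apply: nFL; have [_ _ /(_ p Pp)[n Lpn] _] := Lprim.
apply: (gabriel_primary Fg FI Lprim Lpn) => x Ix.
have [s nPs [|[d E]]] := prufer_valuation pr P x p; first by exists s.
by exfalso; apply: nsat; exists s => //; rewrite E; apply: idealMl => //; exact: Fi.
Qed.

(** Take the contraction of x P D_P for x in P outside R. A prime strictly below P lies in R and so
    cannot contain x^2; and s x = x p with p in P forces s = p. *)
Lemma branched_proper_primary P : branched P -> idempotent_prime P ->
  exists2 L, primary P L & ~ (P `<=` L).
Proof.
move=> [R [RP nRP Rmax]] Pid.
have /existsNP[x /not_implyP[Px nRx]] : ~ (P `<=` R).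
  by move=> PR; apply: nRP; exact: spec_eq.
have x0 : x != 0 by apply: contra_notN nRx => /eqP ->; exact: spec0.
pose I := [set y | exists2 p, P p & y = x * p].
have Ii : is_ideal I.
  split; first by exists 0; [exact: spec0 | rewrite mulr0].
    by move=> _ _ [p Pp ->] [q Pq ->]; exists (p + q); [exact: specD | rewrite mulrDr].
  by move=> d _ [p Pp ->]; exists (d * p); [exact: specMl | rewrite mulrCA].
have IP : I `<=` P by move=> _ [p Pp ->]; exact: specMl.
exists (sat P I).
  apply: sat_primary => // Q IQ QP; apply: contrapT => nQP; apply: nRx.
  by apply: (Rmax Q QP nQP); have /specM[] // : Q (x * x) by apply: IQ; exists x.
move=> /(_ x Px)[s nPs [p Pp E]]; apply: nPs.
by have -> : s = p by apply: (mulfI x0); rewrite -E mulrC.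
Qed.

Lemma pair_filter_prime A B P : standard_pair A B -> pair_filter A B P <-> ~ A P.
Proof.
move=> [A0 Adown Bst]; split=> [[_ PA _] AP|nAP]; first exact: (PA P AP).
split=> // [Q AQ PQ|Q BQ q Qq]; first exact/nAP/(Adown P Q).
have [_ _ _ QA] := Bst Q BQ.
have [PQ|/existsNP[x /not_implyP[Px nQx]]] := pselect (P `<=` Q); last first.
  by exists x => //; exact: specMr.
have [->|/eqP nPQ] := eqVneq P Q; first exact: sub_sat.
by exfalso; apply: nAP; exact: QA.
Qed.

Lemma prime_support_pair A B :
  standard_pair A B -> prime_support (pair_filter A B) = A.
Proof.
move=> st; apply/seteqP; split=> P; rewrite /prime_support /= pair_filter_prime //; first by move/contrapT.
by move=> AP; apply.
Qed.

(** If P is in neither A nor B, all P-primary ideals L are in the filter: a prime Q containing L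
    contains P, so Q in A would put P into A, and so would Q in B, where P is strictly below Q. *)
Lemma primary_support_pair A B :
  standard_pair A B -> primary_support (pair_filter A B) = B.
Proof.
move=> st; have [A0 Adown Bst] := st; apply/seteqP; split=> P.
  move=> [Pid /(pair_filter_prime _ st) nAP [L [Li LP Lrad Lsat] nFL]].
  apply: contrapT => nBP; apply: nFL; split=> // [Q AQ LQ|Q BQ q Qq].
    apply: nAP; apply: (Adown P Q) => // x Px; have [n /LQ Qxn] := Lrad x Px.
    by apply: contrapT => nQx; exact: (specNX nQx) Qxn.
  have [LQ|/existsNP[x /not_implyP[Lx nQx]]] := pselect (L `<=` Q); last first.
    by exists x => //; exact: idealMr.
  have PQ : P `<=` Q.
    move=> x Px; have [n /LQ Qxn] := Lrad x Px.
    by apply: contrapT => nQx; exact: (specNX nQx) Qxn.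
  exfalso; have [QP|/eqP QP] := eqVneq P Q; first by apply: nBP; rewrite QP.
  by apply: nAP; have [_ _ _] := Bst Q BQ; apply.
move=> BP; have [Pid nAP Pbr PA] := Bst P BP.
have [L Lprim nPL] := branched_proper_primary Pbr Pid; have [Li LP Lrad Lsat] := Lprim.
split=> //; first exact/pair_filter_prime.
exists L => // -[_ _ /(_ P BP) PL]; apply: nPL => x /PL[s nPs]; exact: Lsat.
Qed.

End SpectralPairs.

(** * Transport of pairs along an order isomorphism of spectra that respects idempotency *)

Section Transfer.
Variables (D1 D2 : idomainType) (psi : Spec D2 -> Spec D1) (phi : Spec D1 -> Spec D2).
Hypotheses (phiK : cancel phi psi) (psiK : cancel psi phi).
Hypothesis psi_le : forall P Q : Spec D2, P `<=` Q <-> psi P `<=` psi Q.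
Hypothesis psi_idem : forall P : Spec D2, idempotent_prime P <-> idempotent_prime (psi P).

Lemma standard_pair_preimage A B :
  standard_pair A B -> standard_pair (psi @^-1` A) (psi @^-1` B).
Proof.
move=> [[P AP] Adown Bst]; split.
- by exists (phi P); rewrite /= phiK.
- by move=> Q R AR /psi_le; exact: Adown.
have neq (Q R : Spec D2) : Q <> R -> psi Q <> psi R by move=> nQR /(can_inj psiK).
move=> {P AP} P BP; have [Pid nAP [R [RP nRP Rmax]] PA] := Bst _ BP; split=> //.
- exact/psi_idem.
- exists (phi R); split.
  + by apply/psi_le; rewrite phiK.
  + by move=> E; apply: nRP; rewrite -E phiK.
  + by move=> Q /psi_le QP /neq nQP; apply/psi_le; rewrite phiK; exact: Rmax.
- by move=> Q /psi_le QP /neq nQP; exact: PA.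
Qed.

Definition transfer (F : set (set D1)) : set (set D2) :=
  pair_filter (psi @^-1` prime_support F) (psi @^-1` primary_support F).

(** A prime in the primary support of G belongs to the primary support of F if it is in F, and to
    the prime support of F otherwise. *)
Lemma transfer_mono F G : F `<=` G -> transfer F `<=` transfer G.
Proof.
move=> FG; apply: pair_filterS => P; first by move=> nGP FP; exact/nGP/FG.
move=> [Pid GP [L Lprim nGL]]; have [FP|nFP] := pselect (F (psi P)); last by left.
by right; split=> //; exists L => // /FG.
Qed.

Lemma star_filter_transfer (pr1 : prufer D1) (s : SStar_st D1) :
  exists t : SStar_st D2, star_filter t = transfer (star_filter s).
Proof.
have sst := support_standard pr1 (star_filter_gabriel s) (@star_filter_proper _ s).
have [A0 _ Bid] := standard_pair_preimage sst.
apply: gabriel_star_filter; last exact: pair_filter_proper.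
by apply: pair_filter_gabriel => P /Bid[].
Qed.

End Transfer.

Lemma transferK (D1 D2 : idomainType) (phi : Spec D1 -> Spec D2) (psi : Spec D2 -> Spec D1)
    (F : set (set D1)) :
  prufer D1 -> prufer D2 -> isolated_minimal_primes D1 ->
  cancel phi psi -> cancel psi phi -> (forall P Q : Spec D2, P `<=` Q <-> psi P `<=` psi Q) ->
  (forall P : Spec D2, idempotent_prime P <-> idempotent_prime (psi P)) ->
  gabriel F -> ~ F [set 0] -> transfer phi (transfer psi F) = F.
Proof.
move=> pr1 pr2 iso1 phiK psiK ple pid Fg nF0.
have st := standard_pair_preimage phiK psiK ple pid (support_standard pr1 Fg nF0).
rewrite {1}/transfer prime_support_pair // primary_support_pair //.
rewrite -[RHS](gabriel_pair_filter pr1 iso1 Fg); congr pair_filter;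
  by apply/seteqP; split=> P; rewrite /= phiK.
Qed.

(** * Consequences of continuity and of min-scatteredness *)

Section Topology.

Lemma zariski_continuous (D1 D2 : idomainType) (f : Spec D1 -> Spec D2) (S : set D2) :
  continuous f -> exists S' : set D1, f @^-1` zariski_closed S = zariski_closed S'.
Proof.
move=> /continuousP/(_ (~` zariski_closed S)) [|S' E]; first by exists S.
by exists S'; apply: setC_inj; rewrite -E preimage_setC.
Qed.

Lemma zariski_continuous_le (D1 D2 : idomainType) (f : Spec D1 -> Spec D2) (P Q : Spec D1) :
  continuous f -> P `<=` Q -> f P `<=` f Q.
Proof.
move=> /(zariski_continuous (f P))[S' E] PQ.
suff : (f @^-1` zariski_closed (f P)) Q by [].
by rewrite E; apply: subset_trans PQ; rewrite -[_ `<=` _]/(zariski_closed S' P) -E.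
Qed.

(** Without isolated points, X equals its derived set, so by induction every iterated derived set is
    X and none is empty. *)
Lemma scattered_isolated (T : topologicalType) (X : set T) :
  scattered X -> X !=set0 -> exists x, isolated X x.
Proof.
move=> [W [R [Dr [Rwo [Dr0 DrS Drlim] [w Drw]]]]] [x Xx].
apply: contrapT => noiso.
have dX : derived X = X.
  by apply/seteqP; split=> y; [case | split=> // iy; apply: noiso; exists y].
suff DrX v : Dr v = X by move: Xx; rewrite -(DrX w) Drw.
(* Reflexivity, antisymmetry and totality come from the unique minima of sets with one or two
   elements. *)
have Rrefl u : R u u.
  have [|z [[/= /eqP -> lb] _]] := Rwo (pred1 u); first by exists u; exact: eqxx.
  by apply: lb; exact: eqxx.
have Ranti u u' : R u u' -> R u' u -> u = u'.
  move=> uu' u'u; have [|z [_ zuniq]] := Rwo (pred2 u u').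
    by exists u; rewrite inE eqxx.
  rewrite -(zuniq u); last first.
    by split=> [|x']; rewrite !inE ?eqxx // => /orP[]/eqP->.
  apply: zuniq; split=> [|x']; rewrite !inE ?eqxx ?orbT // => /orP[]/eqP-> //.
have Rtotal u u' : ~ R u u' -> R u' u.
  move=> nuu'; have [|z [[+ lb] _]] := Rwo (pred2 u u').
    by exists u; rewrite inE eqxx.
  rewrite inE => /orP[]/eqP zE; rewrite zE in lb; last by apply: lb; rewrite inE eqxx.
  by exfalso; apply: nuu'; apply: lb; rewrite inE eqxx orbT.
apply: contrapT => Drv.
have [|z [[zbad zmin] _]] := Rwo [pred u | ~~ `[< Dr u = X >]].
  by exists v; rewrite inE; apply/asboolPn.
move: zbad; rewrite inE => /asboolPn; apply.
have DrX u : below R u z -> Dr u = X.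
  move=> [Ruz /eqP uz]; apply: contrapT => /asboolPn ubad; apply: uz.
  by apply: Ranti => //; apply: zmin; rewrite inE.
have [/Dr0//|zn0] := pselect (is_zero R z).
have [[u uz]|nsucc] := pselect (exists u, is_succ R u z).
  by rewrite (DrS _ _ uz) DrX; [exact: dX | case: uz].
rewrite Drlim; last by split=> // u uz; apply: nsucc; exists u.
have /existsNP[u nzu] := zn0.
have uz : below R u z.
  by split; [exact: Rtotal | apply: contra_notN nzu => /eqP ->; exact: Rrefl].
by apply/seteqP; split=> [y /(_ u uz)|y Xy u' /DrX ->//]; rewrite DrX.
Qed.

Lemma min_scattered_isolated (D : idomainType) :
  prufer D -> min_scattered D -> isolated_minimal_primes D.
Proof.
move=> pr scat I Ii nI1; have [M IM] := ideal_in_prime Ii nI1.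
have [N Nmin _] := exists_minimal_prime pr IM.
have [P [/set_mem Pmin [V + VP]]] :
  exists P, isolated (minimal_primes I) P by apply: scattered_isolated (scat I Ii) _; exists N.
rewrite nbhsE => -[U [[S US] UP] UV].
have : U P by [].
rewrite US => /existsNP[a /not_implyP[Sa nPa]].
exists P, a; split=> // Q Qmin QP; apply: contrapT => nQa; apply: QP.
suff : (V `&` minimal_primes I) Q by rewrite VP.
by split=> //; apply: UV; rewrite US => /(_ a Sa).
Qed.

(** The preimage of V(I) is closed, hence V(J) for an intersection J of primes, and minimal primes
    of I and of J correspond. *)
Lemma isolated_minimal_primes_homeo (D1 D2 : idomainType)
    (phi : Spec D1 -> Spec D2) (psi : Spec D2 -> Spec D1) :
  cancel phi psi -> cancel psi phi -> continuous phi -> continuous psi ->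
  isolated_minimal_primes D1 -> prufer D2 -> isolated_minimal_primes D2.
Proof.
move=> phiK psiK cphi cpsi iso1 pr2 I Ii nI1.
have [S E] := zariski_continuous I cphi.
have IE (P : Spec D1) : S `<=` P <-> I `<=` phi P.
  by rewrite -[X in X <-> _]/(zariski_closed S P) -E.
pose J := [set x | forall P : Spec D1, S `<=` P -> P x].
have Ji : is_ideal J.
  split; first by move=> P _; exact: spec0.
    by move=> x y Jx Jy P SP; apply: specD; [exact: Jx | exact: Jy].
  by move=> d x Jx P SP; apply: specMl; exact: Jx.
have JE (P : Spec D1) : J `<=` P <-> I `<=` phi P.
  rewrite -IE; split=> [JP x Sx|SP x]; last exact.
  by apply: JP => Q; exact.
have JE' (P : Spec D2) : J `<=` psi P <-> I `<=` P by rewrite JE psiK.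
have minE (P : Spec D2) : minimal_primes I P -> minimal_primes J (psi P).
  move=> [IP Pmin]; split; first exact/JE'.
  move=> Q /JE IQ /(zariski_continuous_le cphi); rewrite psiK => QP.
  by rewrite -(Pmin _ IQ QP) phiK.
have [M IM] := ideal_in_prime Ii nI1.
have [|P [a [[JP Pmin] nPa Qa]]] := iso1 J Ji.
  by move=> J1; apply: (@spec1 _ (psi M)); apply: (JE' M).2.
have [S2 E2] := zariski_continuous [set a] cpsi.
(* V(S2) is the image of V(a) under [phi]. It misses [phi P], as a is outside P, and any b in S2
   outside [phi P] isolates it. *)
have /existsNP[b /not_implyP[Sb nPb]] : ~ (S2 `<=` phi P).
  rewrite -[_ `<=` _]/(zariski_closed S2 (phi P)) -E2 /= phiK.
  by move=> /(_ a erefl).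
exists (phi P), b; split=> //.
  split; first exact/JE.
  move=> Q /JE' JQ /(zariski_continuous_le cpsi); rewrite phiK => QP.
  by rewrite -(Pmin _ JQ QP) psiK.
move=> Q Qmin QP.
suff : zariski_closed S2 Q by apply.
rewrite -E2 => _ ->; apply: Qa; first exact: minE.
by move=> PE; apply: QP; rewrite -PE psiK.
Qed.

End Topology.

Theorem theorem6p9 (D1 D2 : idomainType)
  (prufer1 : prufer D1) (prufer2 : prufer D2)
  (homeo : exists phi : Spec D1 -> Spec D2,
     homeomorphism phi /\
     forall P : Spec D1, idempotent_prime P <-> idempotent_prime (phi P))
  (scattered1 : min_scattered D1) :
  exists Phi : SStar_st D1 -> SStar_st D2, order_isomorphism Phi.
Proof.
have [phi [[psi [phiK psiK cphi cpsi]] idem1]] := homeo.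
have iso1 := min_scattered_isolated prufer1 scattered1.
(* The filters over [D2] must also be determined by their pairs, for [Psi] to be a two-sided inverse
   of [Phi]. *)
have iso2 := isolated_minimal_primes_homeo phiK psiK cphi cpsi iso1 prufer2.
have le1 (P Q : Spec D1) : P `<=` Q <-> phi P `<=` phi Q.
  split; first exact: zariski_continuous_le.
  by move=> /(zariski_continuous_le cpsi); rewrite !phiK.
have le2 (P Q : Spec D2) : P `<=` Q <-> psi P `<=` psi Q by rewrite le1 !psiK.
have idem2 (P : Spec D2) : idempotent_prime P <-> idempotent_prime (psi P) by rewrite idem1 psiK.
have [Phi PhiE] := choice (star_filter_transfer phiK psiK le2 idem2 prufer1).
have [Psi PsiE] := choice (star_filter_transfer psiK phiK le1 idem1 prufer2).
exists Phi; split.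
  exists Psi => s; apply: star_filter_inj; rewrite ?PsiE ?PhiE ?PsiE transferK //;
    by [exact: star_filter_gabriel | exact: star_filter_proper].
move=> s t; rewrite !sstar_le_filter !PhiE; split; first exact: transfer_mono.
(* The order is reflected because transferring back is monotone and recovers both filters. *)
move=> /(transfer_mono (psi := phi)); rewrite !transferK //;
  by [exact: star_filter_gabriel | exact: star_filter_proper].
Qed.
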